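(* If $Q$ is a medial quandle, then for every constant biquandle structure on $Q$, the induced biquandle is also medial.
   Context: A quandle is a set $Q$ with an operation $*$ such that $x*x=x$; each map $x\mapsto x*y$ is a bijection; and $(x*y)*z=(x*z)*(y*z)$. It is medial if $(x*y)*(z*w)=(x*z)*(y*w)$ for all $x,y,z,w$. A biquandle is a set $X$ with two binary operations $\underline{\ast},\overline{\ast}$ such that: (i) $x\,\underline{\ast}\,x=x\,\overline{\ast}\,x$ for all $x$; (ii) for every $y$ the maps $x\mapsto x\,\underline{\ast}\,y$ and $x\mapsto x\,\overline{\ast}\,y$ are bijections of $X$, and $S(x,y)=(y\,\overline{\ast}\,x,\;x\,\underline{\ast}\,y)$ is a bijection of $X\times X$; (iii) for all $x,y,z$: $(x\underline{\ast}y)\underline{\ast}(z\underline{\ast}y)=(x\underline{\ast}z)\underline{\ast}(y\overline{\ast}z)$, $(x\underline{\ast}y)\overline{\ast}(z\underline{\ast}y)=(x\overline{\ast}z)\underline{\ast}(y\overline{\ast}z)$, $(x\overline{\ast}y)\overline{\ast}(z\overline{\ast}y)=(x\overline{\ast}z)\overline{\ast}(y\underline{\ast}z)$. A biquandle is medial if $(x\underline{\ast}y)\underline{\ast}(z\underline{\ast}w)=(x\underline{\ast}z)\underline{\ast}(y\underline{\ast}w)$, $(x\underline{\ast}y)\overline{\ast}(z\underline{\ast}w)=(x\overline{\ast}z)\underline{\ast}(y\overline{\ast}w)$, $(x\overline{\ast}y)\overline{\ast}(z\overline{\ast}w)=(x\overline{\ast}z)\overline{\ast}(y\overline{\ast}w)$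 for all $x,y,z,w$. A biquandle structure on a quandle $(Q,* )$ is a family of quandle automorphisms $\{\beta_y\mid y\in Q\}$ of $Q$ such that (1) $\beta_{\beta_y(x*y)}\circ\beta_y=\beta_{\beta_x(y)}\circ\beta_x$ for all $x,y\in Q$, and (2) $y\mapsto\beta_y(y)$ is a bijection of $Q$. It is constant if $\beta_y=\beta_z$ for all $y,z\in Q$. The induced biquandle is the set $Q$ with $x\,\underline{\ast}\,y=\beta_y(x*y)$ and $x\,\overline{\ast}\,y=\beta_y(x)$ (this is a biquandle, a known fact). *)

(* Defs.v *)
From mathcomp Require Import all_boot.
From mathcomp Require Import boolp.

Set Implicit Arguments.
Unset Strict Implicit.
Unset Printing Implicit Defensive.

Declare Scope quandle_scope.
Delimit Scope quandle_scope with Qdl.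
Local Open Scope quandle_scope.

Record quandle := Quandle {
  quandle_sort :> Type;
  qop : quandle_sort -> quandle_sort -> quandle_sort;
  qop_idem : forall x, qop x x = x;
  qop_bij : forall y, bijective (fun x => qop x y);
  qop_distr : forall x y z, qop (qop x y) z = qop (qop x z) (qop y z)
}.

Notation "x * y" := (qop x y) : quandle_scope.

Definition medial_quandle (Q : quandle) : Prop :=
  forall x y z w : Q, (x * y) * (z * w) = (x * z) * (y * w).

Definition quandle_automorphism (Q : quandle) (f : Q -> Q) : Prop :=
  bijective f /\ {morph f : x y / x * y}.

(* [bunder x y] is the underlined product of x and y, [bover x y] the
   overlined one. *)
Reserved Notation "x *_ y" (at level 40, left associativity).
Reserved Notation "x *^ y" (at level 40, left associativity).

Record biquandle := Biquandle {
  biquandle_sort :> Type;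
  bunder : biquandle_sort -> biquandle_sort -> biquandle_sort
    where "x *_ y" := (bunder x y);
  bover : biquandle_sort -> biquandle_sort -> biquandle_sort
    where "x *^ y" := (bover x y);
  bdiag : forall x, x *_ x = x *^ x;
  bunder_bij : forall y, bijective (fun x => x *_ y);
  bover_bij : forall y, bijective (fun x => x *^ y);
  bswitch_bij : bijective (fun p : biquandle_sort * biquandle_sort =>
                             (p.2 *^ p.1, p.1 *_ p.2));
  bexch_uu : forall x y z,
    (x *_ y) *_ (z *_ y) = (x *_ z) *_ (y *^ z);
  bexch_uo : forall x y z,
    (x *_ y) *^ (z *_ y) = (x *^ z) *_ (y *^ z);
  bexch_oo : forall x y z,
    (x *^ y) *^ (z *^ y) = (x *^ z) *^ (y *_ z)
}.

Notation "x *_ y" := (bunder x y) : quandle_scope.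
Notation "x *^ y" := (bover x y) : quandle_scope.

Definition medial_biquandle (X : biquandle) : Prop :=
  [/\ forall x y z w : X, (x *_ y) *_ (z *_ w) = (x *_ z) *_ (y *_ w),
      forall x y z w : X, (x *_ y) *^ (z *_ w) = (x *^ z) *_ (y *^ w)
    & forall x y z w : X, (x *^ y) *^ (z *^ w) = (x *^ z) *^ (y *^ w)].

Record biquandle_structure (Q : quandle) := BiquandleStructure {
  bstr :> Q -> Q -> Q;
  bstr_aut : forall y, quandle_automorphism (bstr y);
  bstr_comp : forall x y : Q,
    bstr (bstr y (x * y)) \o bstr y = bstr (bstr x y) \o bstr x;
  bstr_diag_bij : bijective (fun y => bstr y y)
}.

Definition constant_structure (Q : quandle) (b : biquandle_structure Q) : Prop :=
  forall y z : Q, b y = b z.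

Section InducedBiquandle.

Variables (Q : quandle) (b : biquandle_structure Q).

Definition induced_under (x y : Q) : Q := b y (x * y).
Definition induced_over (x y : Q) : Q := b y x.

Lemma bstrM (u x y : Q) : b u (x * y) = b u x * b u y.
Proof. exact: (bstr_aut b u).2. Qed.

Lemma bstr_compE (x y u : Q) : b (b y (x * y)) (b y u) = b (b x y) (b x u).
Proof. exact: (congr1 (fun f => f u) (bstr_comp b x y)). Qed.

Lemma induced_diag (x : Q) : induced_under x x = induced_over x x.
Proof. by rewrite /induced_under qop_idem. Qed.

Lemma induced_under_bij (y : Q) : bijective (fun x => induced_under x y).
Proof. exact: bij_comp (bstr_aut b y).1 (qop_bij y). Qed.

Lemma induced_over_bij (y : Q) : bijective (fun x => induced_over x y).
Proof. exact: (bstr_aut b y).1. Qed.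

Lemma induced_switch_bij : bijective (fun p : (Q * Q)%type =>
  (induced_over p.2 p.1, induced_under p.1 p.2)).
Proof.
have inverses (f : Q -> Q -> Q) : (forall y, bijective (f y)) ->
    exists g, forall y, cancel (f y) (g y) /\ cancel (g y) (f y).
  move=> fbij; have gP y : exists h, cancel (f y) h /\ cancel h (f y).
    by have [h fK hK] := fbij y; exists h.
  by have [g] := choice gP; exists g.
have [bV bVK] := inverses _ (fun y => (bstr_aut b y).1).
have [uV uVK] := inverses (fun y x => induced_under x y) induced_under_bij.
have [d dK Kd] := bstr_diag_bij b.
pose Y (p : (Q * Q)%type) := d (bV p.2 (b p.1 p.1)).
exists (fun p => (uV (Y p) p.2, Y p)) => [[x y]|[s t]] /=.
  rewrite /Y /= /induced_over -bstr_compE -/(induced_under x y).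
  by rewrite (bVK _).1 dK (uVK y).1.
set y := Y _; set x := uV y t.
have xyE : induced_under x y = t by exact: (uVK y).2.
congr pair => //; apply: (can_inj dK).
by rewrite /induced_over -bstr_compE -/(induced_under x y) xyE Kd (bVK _).2.
Qed.

Lemma induced_exch_uu (x y z : Q) :
  induced_under (induced_under x y) (induced_under z y) =
  induced_under (induced_under x z) (induced_over y z).
Proof. by rewrite /induced_under /induced_over -!bstrM bstr_compE -qop_distr. Qed.

Lemma induced_exch_uo (x y z : Q) :
  induced_over (induced_under x y) (induced_under z y) =
  induced_under (induced_over x z) (induced_over y z).
Proof. by rewrite /induced_under /induced_over -bstrM bstr_compE. Qed.

Lemma induced_exch_oo (x y z : Q) :
  induced_over (induced_over x y) (induced_over z y) =
  induced_over (induced_over x z) (induced_under y z).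
Proof. by rewrite /induced_under /induced_over bstr_compE. Qed.

Definition induced_biquandle : biquandle :=
  Biquandle induced_diag induced_under_bij induced_over_bij induced_switch_bij
    induced_exch_uu induced_exch_uo induced_exch_oo.

End InducedBiquandle.

(* Main.v *)
Require Import Defs.
From mathcomp Require Import all_boot.

(** All [b y] are one automorphism β, so the two operations become β(x * y) and β(x). Since β
    preserves [*], the first identity is β² applied to the medial law of [Q]. *)

Theorem lemma3p10 (Q : quandle) (medQ : medial_quandle Q)
    (b : biquandle_structure Q) (constb : constant_structure b) :
  medial_biquandle (induced_biquandle b).
Proof.
split=> x y z w; rewrite /= /induced_under /induced_over.
(* [x] serves as an arbitrary common index for β. *)
- by rewrite !(constb _ x) -!bstrM medQ.
(* Here [z] and [w] occur only as indices or inside them; both sides are β(β(x) * β(y)). *)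
- by rewrite !(constb _ x) bstrM.
(* Both sides are β²(x). *)
- by rewrite !(constb _ x).
Qed.
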